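(* For real quadratic fields $K$, the additive semigroups $\mathcal{O}_K^+(+)$ are pairwise non-isomorphic: if $K_1\neq K_2$ are real quadratic fields, then there is no semigroup isomorphism $\mathcal{O}_{K_1}^+(+)\to\mathcal{O}_{K_2}^+(+)$.
   Context: For a real quadratic field $K$ with ring of integers $\mathcal{O}_K$, $\mathcal{O}_K^+$ denotes the set of totally positive elements of $\mathcal{O}_K$ (those $\alpha$ with $\alpha>0$ and $\alpha'>0$, where $\alpha'$ is the Galois conjugate), viewed as a semigroup under addition. *)

(* Defs.v *)
From HB Require Import structures.
From mathcomp Require Import all_boot all_order all_algebra all_field ring.
From mathcomp Require Import boolp classical_sets functions reals.
Set Implicit Arguments.
Unset Strict Implicit.
Unset Printing Implicit Defensive.
Import Order.TTheory GRing.Theory Num.Theory.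
Local Open Scope ring_scope.
Local Open Scope classical_set_scope.

(* The embedding is part of the data: it presents the field as a subfield of R,
   so that the sign of an element and equality of two such fields make sense. *)
Record realQuadraticField (R : realType) := RealQuadraticField {
  rq_field :> fieldExtType rat;
  rq_dim : \dim {:rq_field} = 2%N;
  rq_embed : {rmorphism rq_field -> R}
}.

Section GaloisConjugate.
Variable K : fieldExtType rat.
Hypothesis dimK : \dim {:K} = 2%N.

Lemma quadratic_roots : exists x y : K,
  [/\ <<1%VS; x>>%VS = fullv, y != x, root (minPoly 1 x) y &
      forall z, root (minPoly 1 x) z -> z = x \/ z = y].
Proof.
have [x Nx] : exists x : K, x \notin 1%VS.
  have /subvPn[x _ Nx] : ~~ ({:K} <= 1)%VS.
    by apply/negP => /dimvS; rewrite dimK dimv1.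
  by exists x.
have dx : adjoin_degree 1 x = 2%N.
  have := adjoin_deg_eq1 1%AS x; rewrite (negPf Nx).
  have : (\dim <<1%VS; x>> <= 2)%N by rewrite -dimK dimvS ?subvf.
  rewrite (dim_Fadjoin 1%AS) dimv1 muln1.
  have : (0 < adjoin_degree 1 x)%N by [].
  by case: (adjoin_degree 1 x) => [|[|[|]]].
have genx : <<1%VS; x>>%VS = fullv.
  apply/eqP; rewrite eqEdim subvf dimK.
  by rewrite (dim_Fadjoin 1%AS) dimv1 muln1 dx.
set p := minPoly 1 x; have sp : size p = 3%N by rewrite size_minPoly dx.
have pE z : p.[z] = p`_0 + p`_1 * z + z ^+ 2.
  rewrite horner_coef sp !big_ord_recl big_ord0 /= /bump /= expr0 expr1 mulr1.
  have := monic_minPoly 1%AS x; rewrite -/p monicE lead_coefE sp => /eqP ->.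
  by rewrite mul1r addr0 addrA.
have p1 : p`_1 \in 1%VS by apply: (polyOverP (minPolyOver 1%AS x)).
have px : p.[x] = 0 by apply: minPolyxx.
have pyz z : p.[z] = (z - x) * (z - (- p`_1 - x)).
  have -> : p.[z] = p.[z] - p.[x] by rewrite px subr0.
  by rewrite !pE; ring.
exists x, (- p`_1 - x); split=> //.
- apply: contra Nx => /eqP e.
  have -> : x = (- p`_1) * 2%:R^-1.
    apply: (@mulIf _ 2%:R); first by rewrite -(rmorph_nat (in_alg K)) fmorph_eq0.
    rewrite mulfVK; last by rewrite -(rmorph_nat (in_alg K)) fmorph_eq0.
    by rewrite mulr_natr mulr2n -{2}e addrCA subrr addr0.
  rewrite (@rpredM _ 1%AS) ?rpredN //.
  by rewrite (@rpredV _ 1%AS) (@rpred_nat _ 1%AS).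
- by rewrite rootE pyz subrr mulr0.
- move=> z; rewrite rootE pyz mulf_eq0 !subr_eq0.
  by case/orP=> /eqP; [left | right].
Qed.

Lemma galois_conj_exists : exists s : 'AEnd(K), s != \1%AF.
Proof.
have [x [y [genx yx ry _]]] := quadratic_roots.
have h1 : kHom 1 1 (\1%VF : 'End(K)) by exact: (k1AHom 1 \1%AF).
have fp : root (map_poly (\1%VF : 'End(K)) (minPoly 1 x)) y.
  by rewrite (kHom_poly_id h1) ?minPolyOver.
have := kHomExtendP (K := 1%AS) (E := 1%AS) (subvv _) h1 fp.
rewrite genx k1HomE => h.
exists (AHom h); apply: contraNneq yx => /(congr1 (fun s : 'AEnd(K) => s x)) /=.
rewrite (kHomExtend_val (K := 1%AS) h1 fp) => ->.
by rewrite id_lfunE.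
Qed.

Definition galois_conj : 'AEnd(K) := xchoose galois_conj_exists.

Lemma galois_conj_neq1 : galois_conj != \1%AF.
Proof. exact: (xchooseP galois_conj_exists). Qed.

Lemma galois_conj_uniq (s : 'AEnd(K)) : s != \1%AF -> s = galois_conj.
Proof.
have [x [y [genx yx ry allr]]] := quadratic_roots.
have eqx (s1 s2 : 'AEnd(K)) : s1 x = s2 x -> s1 = s2.
  move=> e; apply/val_inj/lfunP => u /=.
  have : u \in <<1%VS; x>>%VS by rewrite genx memvf.
  case/Fadjoin_polyP => q q1 ->.
  have hor (t : 'AEnd(K)) : t q.[x] = q.[t x].
    rewrite (kHom_horner (k1AHom fullv t)) ?memvf //; last first.
      exact: (polyOverSv (sub1v _) q1).
    by rewrite (kHom_poly_id (k1AHom fullv t)).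
  by rewrite !hor e.
have sy (t : 'AEnd(K)) : t != \1%AF -> t x = y.
  move=> nt; have rt : root (minPoly 1 x) (t x).
    apply: (kHom_root_id (sub1v _) (k1AHom fullv t)) => //.
    - exact: minPolyOver.
    - exact: memvf.
    - exact: root_minPoly.
  case: (allr _ rt) => // e; case/eqP: nt; apply: eqx.
  by rewrite e id_lfunE.
by move=> ns; apply: eqx; rewrite !sy ?galois_conj_neq1.
Qed.

End GaloisConjugate.

Definition rq_conj (R : realType) (K : realQuadraticField R) : K -> K :=
  galois_conj (rq_dim K).

Definition ring_of_integers (K : fieldExtType rat) : set K :=
  [set a | integralOver (intr : int -> K) a].

Arguments ring_of_integers K : clear implicits.

Definition totally_positive (R : realType) (K : realQuadraticField R) (a : K) :=
  0 < rq_embed K a /\ 0 < rq_embed K (rq_conj a).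

Definition totally_positive_integers (R : realType) (K : realQuadraticField R) :
    set K :=
  [set a | ring_of_integers K a /\ totally_positive a].

Arguments totally_positive_integers {R} K.

(* A and B are meant to be closed under addition; set_bij only constrains the
   values of f on A. *)
Definition semigroup_isomorphism (U V : nmodType) (A : set U) (B : set V)
    (f : U -> V) : Prop :=
  set_bij A B f /\ (forall a b, A a -> A b -> f (a + b) = f a + f b).

(* Main.v *)
From HB Require Import structures.
Require Import Defs.
From mathcomp Require Import all_boot all_order all_algebra all_field ring.
From mathcomp Require Import boolp classical_sets functions reals.
Set Implicit Arguments.
Unset Strict Implicit.
Unset Printing Implicit Defensive.
Import Order.TTheory GRing.Theory Num.Theory.
Local Open Scope ring_scope.
Local Open Scope classical_set_scope.

(* For b totally positive and n, m > 0, the element a m - b n is totally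
   positive iff n / m < min (a / b, a' / b'), the minimum of the two real
   embeddings of a / b.  Total positivity of such differences is expressible in
   the semigroup, so by density of the rationals an isomorphism f satisfies
   min (a / b, a' / b') = min (f a / f b, (f a)' / (f b)').  Taking b = 1 puts
   min (a, a') in K2 for every totally positive integer a, hence, shifting by
   natural numbers, for every integer a of K1.  As a is either min (a, a') or
   - min (- a, - a'), it lies in K2, whence K1 is contained in K2; taking
   f b = 1 instead gives the other inclusion. *)

(** * Clearing denominators and rational approximation *)

Lemma intr_alg_eq0 (K : fieldExtType rat) (n : int) :
  (n%:~R == 0 :> K) = (n == 0).
Proof. by rewrite -(rmorph_int (in_alg K)) fmorph_eq0 intr_eq0. Qed.

(** The scalar is the leading coefficient of an integer multiple of the minimal polynomial of [u].
    This carries the conclusion from integers to the whole field. *)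
Lemma integral_int_scale (K : fieldExtType rat) (u : K) :
  exists2 a : int, a != 0 & ring_of_integers K (a%:~R * u).
Proof.
have [p pE] := polyOver1P (minPolyOver 1%AS u).
have [q [b b0 qE]] := rat_poly_scale p.
have bQ0 : (b%:~R : rat)^-1 != 0 by rewrite invr_eq0 intr_eq0.
have p0 : p != 0.
  by rewrite -(map_poly_eq0 (in_alg K)) -pE monic_neq0 // monic_minPoly.
have q0 : q != 0 by apply: contraNneq p0 => q0; rewrite qE q0 rmorph0 scaler0.
have qu : (map_poly intr q : {poly K}).[u] = 0.
  have := minPolyxx 1%AS u; rewrite pE qE linearZ /= hornerZ => /eqP.
  rewrite mulf_eq0 (fmorph_eq0 (in_alg K)) (negPf bQ0) /= => /eqP.
  rewrite -map_poly_comp; congr (_.[_] = 0).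
  by apply: eq_map_poly => z /=; rewrite -[RHS](rmorph_int (in_alg K)).
set d := (size q).-1; set a := lead_coef q.
have sq : size q = d.+1 by rewrite /d prednK // size_poly_gt0.
exists a; first by rewrite lead_coef_eq0.
(* [a ^ (d - 1) q = r (a X)], so [r] is monic with root [a u]. *)
pose r := 'X^d + \poly_(i < d) (q`_i * a ^+ (d.-1 - i)).
have sr : size r = d.+1.
  by rewrite size_polyDl size_polyXn // ltnS size_poly.
exists r.
  by rewrite monicE lead_coefDl ?lead_coefXn // size_polyXn ltnS size_poly.
have wide (t : {poly int}) x : size t = d.+1 ->
    (map_poly intr t : {poly K}).[x] = \sum_(i < d.+1) (t`_i)%:~R * x ^+ i.
  move=> st; rewrite (@horner_coef_wide _ d.+1) -?st ?size_poly //.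
  by apply: eq_bigr => i _; rewrite coef_map.
have a0 : q`_d != 0 by rewrite lead_coef_eq0.
(* A nonzero constant has no root, so [d] is positive and [d.-1] is not truncated. *)
have d0 : (0 < d)%N.
  rewrite lt0n; apply: contra_eqN qu => /eqP d0.
  by rewrite wide // d0 big_ord1 expr0 mulr1 intr_alg_eq0; move: a0; rewrite d0.
rewrite /root; apply/eqP; rewrite wide //.
transitivity (a%:~R ^+ d.-1 * (map_poly intr q : {poly K}).[u]); last first.
  by rewrite qu mulr0.
rewrite wide // mulr_sumr; apply: eq_bigr => i _.
rewrite coefD coefXn coef_poly exprMn.
have [id | di] := ltnP i d.
  rewrite ltn_eqF // add0r rmorphM rmorphXn /=.
  have -> : a%:~R ^+ d.-1 = a%:~R ^+ (d.-1 - i) * a%:~R ^+ i :> K.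
    by rewrite -exprD subnK // -ltnS prednK.
  by ring.
have -> : i = d :> nat by apply/eqP; rewrite eqn_leq di -ltnS ltn_ord.
by rewrite eqxx addr0 mul1r mulrA -[q`_d]/a -exprSr prednK //.
Qed.

(** A rational strictly between [y] and [x] would be positive because [y] is, hence a quotient of
    positive naturals that refutes the assumption. *)
Lemma le_of_lt_frac (R : realType) (x y : R) : 0 < y ->
  (forall n m, (0 < n)%N -> (0 < m)%N ->
    n%:R / m%:R < x -> n%:R / m%:R < y) -> x <= y.
Proof.
move=> y0 xy; rewrite leNgt; apply/negP => /rat_in_itvoo[q].
rewrite in_itv /= => /andP[yq qx].
have q0 : 0 < q by rewrite -(ltr0q R) (lt_trans y0).
have nE : numq q = `|numq q|%N by rewrite gez0_abs // numq_ge0 ltW.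
have dE : denq q = `|denq q|%N by rewrite gez0_abs // denq_ge0.
have qE : ratr q = `|numq q|%N%:R / `|denq q|%N%:R :> R.
  by rewrite /ratr {1}nE {1}dE.
have := xy `|numq q|%N `|denq q|%N; rewrite -qE !absz_gt0 denq_neq0 numq_eq0.
by rewrite gt_eqF // => /(_ isT isT qx); rewrite ltNge ltW.
Qed.

(** * Total positivity through the smaller real embedding *)

Section LeastEmbedding.
Variables (R : realType) (K : realQuadraticField R).
Implicit Types a b u : K.

(* [rq_conj] itself is a bare function, without morphism structure. *)
Definition rq_embed_conj : K -> R := rq_embed K \o galois_conj (rq_dim K).
HB.instance Definition _ := GRing.RMorphism.on rq_embed_conj.

Definition least_embedding u : R :=
  Num.min (rq_embed K u) (rq_embed_conj u).

Lemma totally_positive_least u : totally_positive u <-> 0 < least_embedding u.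
Proof. by rewrite lt_min; split=> [[? ?]|/andP[]]; [apply/andP | split]. Qed.

Lemma totally_positive_frac a b n m : totally_positive b -> (0 < m)%N ->
  totally_positive (a *+ m - b *+ n) <->
  n%:R / m%:R < least_embedding (a / b).
Proof.
move=> [b0 b0'] m0; rewrite totally_positive_least !lt_min.
have E (g : {rmorphism K -> R}) : 0 < g b ->
    (0 < g (a *+ m - b *+ n)) = (n%:R / m%:R < g (a / b)).
  move=> gb; rewrite rmorphB !rmorphMn fmorph_div subr_gt0.
  by rewrite ltr_pdivrMr ?ltr0n // mulrAC ltr_pdivlMr // mulr_natl mulr_natr.
by rewrite !E.
Qed.

Lemma least_embedding_div_gt0 a b :
  totally_positive a -> totally_positive b -> 0 < least_embedding (a / b).
Proof.
by move=> [a0 a0'] [b0 b0']; rewrite lt_min !fmorph_div !divr_gt0.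
Qed.

Lemma least_embeddingDn u n :
  least_embedding (u + n%:R) = least_embedding u + n%:R.
Proof. by rewrite /least_embedding !rmorphD !rmorph_nat addr_minl. Qed.

Lemma totally_positive_integersD a b :
  totally_positive_integers K a -> totally_positive_integers K b ->
  totally_positive_integers K (a + b).
Proof.
move=> [ia [a0 a0']] [ib [b0 b0']]; split; first exact: integral_add.
split; first by rewrite rmorphD addr_gt0.
by rewrite -[X in _ < X]/(rq_embed_conj _) rmorphD addr_gt0.
Qed.

Lemma totally_positive_integersMn a n : (0 < n)%N ->
  totally_positive_integers K a -> totally_positive_integers K (a *+ n).
Proof.
case: n => // n _ Aa; elim: n => // n IH.
by rewrite mulrS; exact: totally_positive_integersD.
Qed.

Lemma totally_positive_integers1 : totally_positive_integers K 1.
Proof.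
split; first exact: (integral_nat _ 1).
by apply/totally_positive_least; rewrite lt_min !rmorph1 ltr01.
Qed.

Lemma totally_positive_shift u : exists n, totally_positive (u + n%:R).
Proof.
have [n un] : exists n : nat, - least_embedding u < n%:R.
  exists (Num.bound (least_embedding u)).
  by rewrite (le_lt_trans (ler_norm _)) // normrN truncnS_gt.
exists n; apply/totally_positive_least.
by rewrite least_embeddingDn -ltrBlDl sub0r.
Qed.

End LeastEmbedding.

(** * Invariants of a semigroup isomorphism *)

Section SemigroupIsomorphism.
Variables (R : realType) (K1 K2 : realQuadraticField R) (f : K1 -> K2).
Local Notation A := (totally_positive_integers K1).
Local Notation B := (totally_positive_integers K2).
Hypothesis f_iso : semigroup_isomorphism A B f.

(** Additivity is known only on [A], which omits 0, so the induction starts at one copy of [a]. *)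
Lemma semigroup_isomorphismMn a n : (0 < n)%N -> A a -> f (a *+ n) = f a *+ n.
Proof.
case: n => // n _ Aa; elim: n => // n IH.
have [_ fD] := f_iso.
rewrite mulrS fD ?IH -?mulrS //.
exact: totally_positive_integersMn.
Qed.

(* [a m - b n] is totally positive iff [a m = b n + d] is solvable in [A], a
   condition on the semigroup alone. *)
Lemma semigroup_isomorphism_totally_positive a b n m : A a -> A b ->
  (0 < n)%N -> (0 < m)%N ->
  totally_positive (a *+ m - b *+ n) <->
  totally_positive (f a *+ m - f b *+ n).
Proof.
move=> Aa Ab n0 m0; have [[fAB finj fsurj] fD] := f_iso.
have intB (K : realQuadraticField R) (x y : K) :
    totally_positive_integers K x -> totally_positive_integers K y ->
    totally_positive (x *+ m - y *+ n) ->
    totally_positive_integers K (x *+ m - y *+ n).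
  move=> Kx Ky p; split=> //.
  have [ix _] := totally_positive_integersMn m0 Kx.
  have [iy _] := totally_positive_integersMn n0 Ky.
  exact: integral_sub.
have Aam := totally_positive_integersMn m0 Aa.
have Abn := totally_positive_integersMn n0 Ab.
split=> p.
- have Ad := intB _ _ _ Aa Ab p.
  have [_] := fAB _ Ad; congr totally_positive.
  by apply/eqP; rewrite eq_sym subr_eq -!semigroup_isomorphismMn // -fD // subrK.
- have [d Ad fd] := fsurj _ (intB _ _ _ (fAB _ Aa) (fAB _ Ab) p).
  have -> : a *+ m = d + b *+ n; last by rewrite addrK; case: Ad.
  apply: finj; rewrite ?inE //; first exact: totally_positive_integersD.
  by rewrite fD // fd !semigroup_isomorphismMn // subrK.
Qed.

Lemma least_embedding_iso a b : A a -> A b ->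
  least_embedding (a / b) = least_embedding (f a / f b).
Proof.
move=> Aa Ab; have [[fAB _ _] _] := f_iso.
have [[_ pa] [_ pb]] := (Aa, Ab).
have [[_ pfa] [_ pfb]] := (fAB _ Aa, fAB _ Ab).
(* Both sides are positive and exceed the same positive fractions. *)
apply/le_anti/andP; split; apply: le_of_lt_frac => [|n m n0 m0];
  rewrite ?least_embedding_div_gt0 //.
- by move/(totally_positive_frac _ _ pb m0)/semigroup_isomorphism_totally_positive
    /(totally_positive_frac _ _ pfb m0); apply.
- by move/(totally_positive_frac _ _ pfb m0)/semigroup_isomorphism_totally_positive
    /(totally_positive_frac _ _ pb m0); apply.
Qed.

End SemigroupIsomorphism.

(** * Recovering the real subfield from least embeddings *)

(** The minimum is the image of [u] or of its conjugate, and both lie in [K]. *)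
Lemma least_embedding_range (R : realType) (K : realQuadraticField R) (u : K) :
  range (rq_embed K) (least_embedding u).
Proof.
by rewrite /least_embedding minEle; case: ifP => _; [exists u | exists (rq_conj u)].
Qed.

Lemma range_sub_of_least (R : realType) (K1 K2 : realQuadraticField R) :
  (forall a, totally_positive_integers K1 a ->
     range (rq_embed K2) (least_embedding a)) ->
  range (rq_embed K1) `<=` range (rq_embed K2).
Proof.
move=> sub.
have subO u : ring_of_integers K1 u -> range (rq_embed K2) (least_embedding u).
  move=> iu; have [n pun] := totally_positive_shift u.
  have [|v _ vE] := sub (u + n%:R).
    by split=> //; apply: integral_add => //; exact: integral_nat.
  exists (v - n%:R) => //.
  by rewrite rmorphB rmorph_nat vE least_embeddingDn addrK.
move=> _ [u _ <-]; have [c c0 icu] := integral_int_scale u.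
have [v vE] : exists v, rq_embed K2 v = rq_embed K1 (c%:~R * u).
  have [v _ vE] := subO _ icu.
  (* Negation turns the minimum into a maximum: [v] gives the smaller embedding and [- w] the
     larger, and [rq_embed K1] is one of the two. *)
  have [w _ wE] := subO _ (integral_opp icu).
  move: vE wE; rewrite /least_embedding !rmorphN -oppr_max => vE wE.
  have [le | lt] := leP (rq_embed K1 (c%:~R * u)) (rq_embed_conj (c%:~R * u)).
    by exists v; rewrite vE; apply/min_idPl.
  exists (- w); rewrite rmorphN wE opprK; apply/max_idPl; exact: ltW.
exists (v / c%:~R) => //.
rewrite fmorph_div vE rmorphM !rmorph_int mulrC mulKf //.
by rewrite intr_eq0.
Qed.

Theorem theorem4p3 (R : realType) (K1 K2 : realQuadraticField R)
  (K1_neq_K2 : range (rq_embed K1) <> range (rq_embed K2)) :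
  ~ exists f : K1 -> K2,
      semigroup_isomorphism (totally_positive_integers K1)
        (totally_positive_integers K2) f.
Proof.
move=> [f f_iso]; apply: K1_neq_K2; have [[fAB _ fsurj] _] := f_iso.
apply/seteqP; split; apply: range_sub_of_least => a Aa.
- rewrite -[a]divr1 (least_embedding_iso f_iso) //.
    exact: least_embedding_range.
  exact: totally_positive_integers1.
- have [b Ab fb] := fsurj _ Aa.
  (* The preimage [e] of 1 need not be 1, but [b / e] still lies in [K1] and has the same least
     embedding as [a]. *)
  have [e Ae fe] := fsurj _ (totally_positive_integers1 K2).
  rewrite -[a]divr1 -fb -fe -(least_embedding_iso f_iso) //.
  exact: least_embedding_range.
Qed.
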